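(* Let $H=(V,E)$ be a hypergraph, let $S\subseteq V$ with $|S|=k$, and let $I=H[S]=(S,F)$ be the restriction of $H$ to $S$, where $F$ is the set of distinct non-empty traces on $S$ of edges of $H$. For $i=1,\dots,k$, let $x_i$ be a vertex in the subhypergraph $I_i=(S_i,F_i)$, where $S_i=S\setminus\{x_1,\dots,x_{i-1}\}$ and $F_i$ is obtained from $F$ by removing all edges that contain at least one of $x_1,\dots,x_{i-1}$ (so $S_1=S$ and $F_1=F$; $F_{k+1}$ is defined in the same way), and let $F_{x_i}$ be the set of edges of $F_i$ that contain $x_i$. Let $k,j,l\ge 0$ be integers with $k=l+j$. Then $$|F|=\sum_{i=1}^k|F_{x_i}|=\sum_{i=1}^k d_{I_i}(x_i)=\sum_{i=1}^l d_{I_i}(x_i)+|F_{l+1}|\le \sum_{i=1}^{l}d_{I_i}(x_i)+T[H,j].$$ Consequently, $$T[H,k]\le \delta^*(I)\cdot l+T[H,j]\le \delta^*(I)\cdot k\le \check{\delta}(H)\cdot k.$$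
   Context: A hypergraph $H=(V,E)$ has a finite vertex set $V$ and a set $E$ of subsets of $V$ (edges; no multiple edges). For $S\subseteq V$ and $e\in E$, the trace of $e$ on $S$ is $e\cap S$. The restriction (induced subhypergraph) $H[S]$ is the hypergraph on vertex set $S$ whose edges are the distinct traces of edges of $H$ on $S$. The degree $d_H(x)$ is the number of edges of $H$ containing $x$, and $\delta(H)$ is the minimum degree of a vertex of $H$; the same notation is used for subhypergraphs. The pseudo induced subhypergraph of $H$ on $S$ has vertex set $S$ and edge set $\{e\in E: e\subseteq S\}$. The pseudo degeneracy $\delta^*(H)$ is the largest minimum degree of any pseudo induced subhypergraph of $H$. The reduced degeneracy $\check{\delta}(H)$ is the largest pseudo degeneracy of any induced subhypergraph of $H$. The trace function $T[H,k]$ is the largest number of distinct non-empty traces of edges of $H$ on a set $S\subseteq V$ with $|S|=k$.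
   Formalization: The second chain is stated for S with |F| = T[H,k]; its link δ*(I)l+T[H,j] ≤ δ*(I)k, false in general, is replaced by δ*(I)l+|F_{l+1}| ≤ δ*(I)k, T[H,k] ≤ δ*(I)k and δ*(I)l+T[H,j] ≤ δ̌(H)k. *)

(* Defs.v *)
From HB Require Import structures.
From mathcomp Require Import all_boot.

Set Implicit Arguments.
Unset Strict Implicit.
Unset Printing Implicit Defensive.

(* The vertex set is a subset of an ambient finite type, so that all the
   subhypergraphs of a hypergraph live in the same type. *)
Record hypergraph (T : finType) := Hypergraph {
  verts : {set T};
  edges : {set {set T}};
  edges_sub : edges \subset powerset verts }.

Section Hypergraphs.
Variable T : finType.
Implicit Types (H : hypergraph T) (S X : {set T}) (x : T).

Definition degree H x : nat := #|[set e in edges H | x \in e]|.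

(* #|edges H| bounds all degrees, so it is neutral for minn here; a hypergraph
   with no vertex gets minimum degree 0. *)
Definition min_degree H : nat :=
  if verts H == set0 then 0
  else \big[minn/#|edges H|]_(x in verts H) degree H x.

Lemma restriction_sub H S :
  [set e :&: S | e in edges H] \subset powerset (verts H :&: S).
Proof.
apply/subsetP => _ /imsetP[e eE ->]; rewrite powersetE.
by apply: setSI; have /subsetP/(_ e eE) := edges_sub H; rewrite powersetE.
Qed.

(* H[S]; for S \subset verts H the vertex set is S itself. The empty trace is
   an edge as soon as some edge of H misses S. *)
Definition restriction H S := Hypergraph (restriction_sub H S).

Lemma drop_empty_sub H : edges H :\ set0 \subset powerset (verts H).
Proof. exact: subset_trans (subD1set _ _) (edges_sub H). Qed.

Definition drop_empty H := Hypergraph (drop_empty_sub H).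

Lemma pseudo_induced_sub H S :
  [set e in edges H | e \subset S] \subset powerset (verts H :&: S).
Proof.
apply/subsetP => e; rewrite inE powersetE subsetI => /andP[eE ->].
by have /subsetP/(_ e eE) := edges_sub H; rewrite powersetE andbT.
Qed.

Definition pseudo_induced H S := Hypergraph (pseudo_induced_sub H S).

Lemma strong_deletion_sub H X :
  [set e in edges H | [disjoint e & X]] \subset powerset (verts H :\: X).
Proof.
apply/subsetP => e; rewrite inE powersetE subsetD => /andP[eE ->].
by have /subsetP/(_ e eE) := edges_sub H; rewrite powersetE andbT.
Qed.

(* Deletes the vertices of X together with every edge that meets X. *)
Definition strong_deletion H X := Hypergraph (strong_deletion_sub H X).

Definition pseudo_degeneracy H : nat :=
  \max_(S : {set T} | S \subset verts H) min_degree (pseudo_induced H S).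

Definition reduced_degeneracy H : nat :=
  \max_(S : {set T} | S \subset verts H) pseudo_degeneracy (restriction H S).

(* T[H,k], for k <= #|verts H|; the maximum is 0 for larger k. *)
Definition trace_function H (k : nat) : nat :=
  \max_(S : {set T} | (S \subset verts H) && (#|S| == k))
     #|edges (drop_empty (restriction H S))|.

End Hypergraphs.

(* Main.v *)
(* Removing x_i from I_i destroys exactly the edges of F_(x_i), so |F_i| drops
   by the degree of x_i.  Edges of I that avoid the removed vertices are traces
   on the remaining vertices, which bounds |F_(l+1)| by T[H,j].  For the upper
   bounds, choose x_i of minimum degree in the pseudo induced subhypergraph of
   I on the remaining vertices: each step then costs at most the pseudo
   degeneracy of I. *)
Require Import Defs.
From mathcomp Require Import all_boot.

Set Implicit Arguments.
Unset Strict Implicit.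
Unset Printing Implicit Defensive.

Lemma bigminn_le (J : eqType) (r : seq J) (P : pred J) (d : nat) (F : J -> nat) i :
  i \in r -> P i -> \big[minn/d]_(j <- r | P j) F j <= F i.
Proof.
elim: r => // a r IHr; rewrite inE big_cons => /predU1P[->|ir] Pi.
  by rewrite Pi geq_minl.
by case: ifP => _; rewrite ?geq_min IHr ?orbT.
Qed.

(** * Edges inside a vertex subset, and peeling off low-degree vertices *)

Section EdgesWithin.
Variable T : finType.
Implicit Types (H G : hypergraph T) (A B S X : {set T}) (x : T).

Lemma edge_subset H e : e \in edges H -> e \subset verts H.
Proof. by move=> eE; have /subsetP/(_ e eE) := edges_sub H; rewrite powersetE. Qed.

Lemma degree_le_edges H x : degree H x <= #|edges H|.
Proof. by apply/subset_leq_card/subsetP => e; rewrite inE => /andP[]. Qed.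

Lemma min_degree_leP H m :
  verts H != set0 ->
  reflect (exists2 x, x \in verts H & degree H x <= m) (min_degree H <= m).
Proof.
move=> V0; rewrite /min_degree (negPf V0).
have minP := big_ind (fun n => (exists2 x, x \in verts H & degree H x <= n)).
apply: (iffP idP) => [le_m|[x xV le_m]].
  have [x xV] := set0Pn _ V0.
  have [y yV le_y] : exists2 y, y \in verts H &
      degree H y <= \big[minn/#|edges H|]_(x in verts H) degree H x.
    (* Having a vertex of degree at most [n] is preserved by [minn], and it holds of the default
       [#|edges H|] through the witness [x], so the minimum is attained even though the default
       enters the fold. *)
    apply: minP => [|a b ha hb|y yV]; last by exists y.
      by exists x => //; apply: degree_le_edges.
    by rewrite /minn; case: ifP.
  by exists y => //; apply: leq_trans le_y le_m.
by apply: leq_trans (bigminn_le _ _ (mem_index_enum x) xV) le_m.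
Qed.

Lemma degree_pseudo_induced_drop_empty H A x :
  degree (pseudo_induced (drop_empty H) A) x = degree (pseudo_induced H A) x.
Proof.
apply: eq_card => e; rewrite !inE.
by have [->|] := eqVneq e set0; rewrite ?inE ?andbF.
Qed.

Lemma min_degree_mono G H :
  verts G = verts H -> (forall x, degree G x <= degree H x) ->
  min_degree G <= min_degree H.
Proof.
move=> eV ledeg; have [V0|V0] := eqVneq (verts H) set0.
  by rewrite /min_degree eV V0 eqxx.
have [x xV le_x] := min_degree_leP _ V0 (leqnn _).
apply/min_degree_leP; rewrite eV //.
by exists x => //; apply: leq_trans (ledeg x) le_x.
Qed.

(** The empty edge contributes to no degree. This links [I], which lacks the empty trace, to the
    restrictions in [reduced_degeneracy], which may have it. *)
Lemma pseudo_degeneracy_drop_empty H :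
  pseudo_degeneracy (drop_empty H) <= pseudo_degeneracy H.
Proof.
apply/bigmax_leqP => A AV; apply: leq_trans (leq_bigmax_cond _ AV).
by apply: min_degree_mono => // x; rewrite degree_pseudo_induced_drop_empty.
Qed.

Lemma pseudo_degeneracy_restriction_le H S :
  S \subset verts H ->
  pseudo_degeneracy (drop_empty (restriction H S)) <= reduced_degeneracy H.
Proof.
move=> SV; apply: leq_trans (pseudo_degeneracy_drop_empty _) _.
exact: (@leq_bigmax_cond _ (fun A => A \subset verts H)
  (fun S => pseudo_degeneracy (restriction H S)) _ SV).
Qed.

(** An edge inside [A] that avoids [x] is an edge inside [A :\ x]. *)
Lemma edges_pseudo_induced_split H A x :
  #|edges (pseudo_induced H A)| =
  degree (pseudo_induced H A) x + #|edges (pseudo_induced H (A :\ x))|.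
Proof.
rewrite -(cardsID [set e : {set T} | x \in e] (edges _)); congr (_ + _).
  by apply: eq_card => e; rewrite !inE.
by apply: eq_card => e; rewrite !inE subsetD1; case: (x \in e); rewrite ?andbF ?andbT.
Qed.

Lemma low_degree_vertex H A :
  A \subset verts H -> A != set0 ->
  exists2 x, x \in A & degree (pseudo_induced H A) x <= pseudo_degeneracy H.
Proof.
move=> AV A0; have vA : verts (pseudo_induced H A) = A by apply/setIidPr.
have /min_degree_leP := @leq_bigmax_cond _ (fun A => A \subset verts H)
  (fun A => min_degree (pseudo_induced H A)) _ AV.
by rewrite vA; apply.
Qed.

(** Greedy removal: each step takes a vertex of least degree among the edges still inside the
    current set, and [B] is what is left after [m] steps. *)
Lemma pseudo_degeneracy_peeling H A m :
  A \subset verts H -> m <= #|A| ->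
  exists B, [/\ B \subset A, #|A| = m + #|B| &
    #|edges (pseudo_induced H A)|
      <= pseudo_degeneracy H * m + #|edges (pseudo_induced H B)|].
Proof.
elim: m A => [|m IHm] A AV leA; first by exists A; rewrite muln0.
have A0 : A != set0 by rewrite -card_gt0; apply: leq_ltn_trans leA.
have [x xA degx] := low_degree_vertex AV A0.
have cA : #|A| = #|A :\ x|.+1 by rewrite (cardsD1 x A) xA.
have [|B [BA cB leB]] := IHm (A :\ x) (subset_trans (subD1set _ _) AV).
  by rewrite -ltnS -cA.
exists B; split; first exact: subset_trans BA (subD1set _ _).
  by rewrite cA cB addSn.
by rewrite (edges_pseudo_induced_split H A x) mulnS -addnA leq_add.
Qed.

Lemma card_edges_pseudo_induced_le H A :
  A \subset verts H -> set0 \notin edges H ->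
  #|edges (pseudo_induced H A)| <= pseudo_degeneracy H * #|A|.
Proof.
(* Peeling off all [#|A|] vertices leaves [B] empty; only the empty edge could survive, and [H0]
   excludes it. *)
move=> AV H0; have [B [_ cB leB]] := pseudo_degeneracy_peeling AV (leqnn _).
have B0 : B = set0.
  by apply/eqP; rewrite -cards_eq0 -(eqn_add2l #|A|) -cB addn0.
suff E0 : edges (pseudo_induced H B) = set0 by rewrite E0 cards0 addn0 in leB.
apply/setP => e; rewrite !inE B0 subset0; apply/negP => /andP[eE /eqP e0].
by rewrite e0 (negPf H0) in eE.
Qed.

Lemma set0_notin_drop_empty H : set0 \notin edges (drop_empty H).
Proof. by rewrite !inE eqxx. Qed.

Lemma edges_pseudo_inducedT H : edges (pseudo_induced H (verts H)) = edges H.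
Proof.
apply/setP => e; rewrite inE.
by case eE: (e \in edges H); rewrite //= edge_subset.
Qed.

(** Turns the sets [F_i] of a deletion sequence into edges inside a vertex subset, where the bounds
    above apply. *)
Lemma edges_strong_deletion H X :
  edges (strong_deletion H X) = edges (pseudo_induced H (verts H :\: X)).
Proof.
apply/setP => e; rewrite !inE subsetD.
by case eE: (e \in edges H); rewrite //= edge_subset.
Qed.

(** If the trace of [f] on [S] lies inside [A], it equals the trace of [f] on [A]; thus the edges
    counted here are among the non-empty traces on [A]. *)
Lemma card_traces_within_le H S A :
  S \subset verts H -> A \subset S ->
  #|edges (pseudo_induced (drop_empty (restriction H S)) A)|
    <= trace_function H #|A|.
Proof.
move=> SV AS.
have AV : (A \subset verts H) && (#|A| == #|A|) by rewrite (subset_trans AS SV) /=.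
have := @leq_bigmax_cond _ (fun B => (B \subset verts H) && (#|B| == #|A|))
  (fun B => #|edges (drop_empty (restriction H B))|) _ AV.
apply: leq_trans.
apply/subset_leq_card/subsetP => e; rewrite !inE => /andP[/andP[-> /imsetP[f fE ->]] sA].
apply/imsetP; exists f => //.
by rewrite -(setIidPl sA) -setIA (setIidPr AS).
Qed.

Lemma verts_trace H S :
  S \subset verts H -> verts (drop_empty (restriction H S)) = S.
Proof. exact: setIidPr. Qed.

(** The maximizing set of size [j] is arbitrary, so the bound must cover the pseudo degeneracies of
    all restrictions of [H] at once. *)
Lemma trace_function_le_reduced_degeneracy H j :
  trace_function H j <= reduced_degeneracy H * j.
Proof.
apply/bigmax_leqP => S /andP[SV /eqP <-].
rewrite -edges_pseudo_inducedT verts_trace //.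
apply: leq_trans (card_edges_pseudo_induced_le _ _) _; rewrite ?verts_trace //.
  exact: set0_notin_drop_empty.
by rewrite leq_mul2r pseudo_degeneracy_restriction_le ?orbT.
Qed.

End EdgesWithin.

(** * Edge counts along a given deletion sequence *)

Section StrongDeletionSequence.
Variables (T : finType) (I : hypergraph T) (k : nat) (x : 'I_k -> T).

Let removed (i : nat) := [set x m | m : 'I_k & m < i].
Let I_ (i : nat) := strong_deletion I (removed i).

Hypothesis x_valid : forall i : 'I_k, x i \in verts (I_ i).

(** Each [x i] still being a vertex of [I_ i], it differs from all earlier ones. *)
Lemma deletion_sequence_inj : injective x.
Proof.
have ltx (i m : 'I_k) : m < i -> x m != x i.
  move=> mi; apply/eqP => exx.
  have := x_valid i; rewrite inE => /andP[/negP[]]; rewrite -exx.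
  by apply: imset_f; rewrite inE.
move=> i m exx; apply/val_inj/eqP.
by case: ltngtP => // /ltx; rewrite exx eqxx.
Qed.

Lemma removed_subset i : removed i \subset verts I.
Proof.
by apply/subsetP => _ /imsetP[m _ ->]; have := x_valid m; rewrite inE => /andP[].
Qed.

Lemma card_removed i : i <= k -> #|removed i| = i.
Proof.
move=> ik; rewrite card_imset; last exact: deletion_sequence_inj.
rewrite cardsE -sum1_card.
by rewrite (big_ord_narrow_cond ik (P := fun _ => true)) sum1_card card_ord.
Qed.

Lemma removedS (i : 'I_k) : removed i.+1 = x i |: removed i.
Proof.
apply/setP => y; rewrite in_setU1; apply/imsetP/predU1P.
  case=> m; rewrite inE ltnS leq_eqVlt => /orP[/eqP/val_inj->|mi] ->; first by left.
  by right; apply: imset_f; rewrite inE.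
case=> [->|/imsetP[m]]; first by exists i; rewrite ?inE.
by rewrite inE => mi ->; exists m; rewrite ?inE // ltnS ltnW.
Qed.

Lemma edges_deletion_step (i : 'I_k) :
  #|edges (I_ i)| = degree (I_ i) (x i) + #|edges (I_ i.+1)|.
Proof.
rewrite -(cardsID [set e : {set T} | x i \in e]); congr (_ + _).
  by apply: eq_card => e; rewrite !inE.
apply: eq_card => e; rewrite !inE removedS !disjoints_subset.
rewrite setCU setIC -setDE subsetD1.
by case: (x i \in e); rewrite ?andbF ?andbT.
Qed.

Lemma edges_deletion_sum n : n <= k ->
  #|edges I| = \sum_(i < k | i < n) degree (I_ i) (x i) + #|edges (I_ n)|.
Proof.
elim: n => [|n IHn] nk.
  rewrite big_pred0 // add0n; apply: eq_card => e; rewrite inE.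
  have -> : removed 0 = set0.
    by apply/eqP; rewrite -cards_eq0 card_removed.
  by rewrite disjoints_subset setC0 subsetT andbT.
rewrite (IHn (ltnW nk)) (edges_deletion_step (Ordinal nk)) addnA; congr (_ + _).
(* Splits off the term of index [n]; the indices below [n.+1] other than [n] are those below [n]. *)
rewrite [RHS](bigD1 (Ordinal nk)) //= addnC; congr (_ + _).
by apply: eq_bigl => i; rewrite -val_eqE /= ltnS ltn_neqAle andbC.
Qed.

End StrongDeletionSequence.

Theorem lemma2p1 (T : finType) (H : hypergraph T) (S : {set T}) (k l j : nat)
    (SV : S \subset verts H) (cardS : #|S| = k) (klj : k = l + j) :
  let I := drop_empty (restriction H S) in
  let F := edges I in
  (forall x : 'I_k -> T,
     let I_ (i : nat) := strong_deletion I [set x m | m : 'I_k & m < i] in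
     let F_ (i : nat) := edges (I_ i) in
     let Fx (i : 'I_k) := [set e in F_ i | x i \in e] in
     (forall i : 'I_k, x i \in verts (I_ i)) ->
     [/\ #|F| = \sum_(i < k) #|Fx i|,
         \sum_(i < k) #|Fx i| = \sum_(i < k) degree (I_ i) (x i),
         \sum_(i < k) degree (I_ i) (x i)
           = \sum_(i < k | i < l) degree (I_ i) (x i) + #|F_ l|,
         \sum_(i < k | i < l) degree (I_ i) (x i) + #|F_ l|
           <= \sum_(i < k | i < l) degree (I_ i) (x i) + trace_function H j
       & pseudo_degeneracy I * l + #|F_ l| <= pseudo_degeneracy I * k])
  /\ (#|F| = trace_function H k ->
      [/\ trace_function H k <= pseudo_degeneracy I * l + trace_function H j,
          trace_function H k <= pseudo_degeneracy I * k,
          pseudo_degeneracy I * k <= reduced_degeneracy H * k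
        & pseudo_degeneracy I * l + trace_function H j
            <= reduced_degeneracy H * k]).
Proof.
move=> I F; have vI : verts I = S by apply: verts_trace.
have I0 : set0 \notin edges I by apply: set0_notin_drop_empty.
have lk : l <= k by rewrite klj leq_addr.
have FE : edges (pseudo_induced I S) = F by rewrite -vI edges_pseudo_inducedT.
split=> [x I_ F_ Fx x_valid|Fmax].
  have cardR : forall i, i <= k -> #|S :\: [set x m | m : 'I_k & m < i]| = k - i.
    move=> i ik; rewrite cardsD (setIidPr _); last by rewrite -vI; apply: (removed_subset x_valid).
    by rewrite cardS (card_removed x_valid).
  have Fi i : F_ i = edges (pseudo_induced I (S :\: [set x m | m : 'I_k & m < i])).
    by rewrite /F_ edges_strong_deletion vI.
  (* After [k] deletions no vertex of [S] is left, so the bound by [pseudo_degeneracy] times the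
     number of remaining vertices is zero. *)
  have Fk0 : #|F_ k| = 0.
    apply/eqP; rewrite -leqn0 Fi.
    apply: leq_trans (card_edges_pseudo_induced_le _ I0) _; last by rewrite cardR // subnn muln0.
    by rewrite vI subsetDl.
  have sumk : #|F| = \sum_(i < k) degree (I_ i) (x i).
    rewrite (edges_deletion_sum x_valid (leqnn k)) [#|edges _|]Fk0 addn0.
    by apply: eq_bigl => i; rewrite ltn_ord.
  have kl : k - l = j by rewrite klj addKn.
  have cardRl := cardR l lk; rewrite kl in cardRl.
  (* [#|Fx i|] unfolds to [degree (I_ i) (x i)], so [sumk] gives the first equality and the second
     is reflexivity. *)
  split=> //.
  - by rewrite -sumk (edges_deletion_sum x_valid lk).
  - rewrite leq_add2l Fi -[j in trace_function _ j]cardRl.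
    by apply: card_traces_within_le; rewrite ?subsetDl.
  (* The edges of [F_ l] live on the [j] remaining vertices, hence number at most
     [pseudo_degeneracy I * j]. *)
  rewrite [in leqRHS](_ : k = l + j) // mulnDr leq_add2l Fi -[j in _ * j]cardRl.
  by apply: card_edges_pseudo_induced_le; rewrite // vI subsetDl.
have pd_rd : pseudo_degeneracy I <= reduced_degeneracy H.
  exact: pseudo_degeneracy_restriction_le.
split.
(* Here the [l] vertices come from peeling [S], not from a given sequence; the remainder [B] has [j]
   vertices, so the edges inside it are counted by [trace_function H j]. *)
- have [||B [BS cB leB]] := @pseudo_degeneracy_peeling _ I S l; rewrite ?vI ?cardS //.
  rewrite -Fmax -FE (leq_trans leB) // leq_add2l.
  have -> : j = #|B| by apply/eqP; rewrite -(eqn_add2l l) -klj -cardS cB.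
  exact: card_traces_within_le.
- by rewrite -Fmax -FE -cardS card_edges_pseudo_induced_le ?vI.
- by rewrite leq_mul2r pd_rd orbT.
(* [trace_function H j] may be attained on a set unrelated to [S], so it is bounded through
   [reduced_degeneracy H] rather than [pseudo_degeneracy I]. *)
rewrite klj mulnDr leq_add ?trace_function_le_reduced_degeneracy //.
by rewrite leq_mul2r pd_rd orbT.
Qed.
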